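(* Let $M$ be a convex set of equivalent measures on a measurable space $(\Omega,\mathcal F)$ and let $\{f_m,\mathcal F_m\}_{m=0}^\infty$ be a supermartingale relative to $M$ with $\sup_{P\in M}E^P|f_m|<\infty$ for all $m=0,1,2,\dots$. Suppose there exists a nonnegative adapted random process $\{\bar g^0_m\}_{m=1}^\infty$, $E^P\bar g^0_m<\infty$ for $m=1,2,\dots$, $P\in M$, such that $$f_{m-1}-E^P\{f_m|\mathcal F_{m-1}\}=E^P\{\bar g^0_m|\mathcal F_{m-1}\},\qquad m=1,2,\dots,\ P\in M.$$ Then $\{f_m,\mathcal F_m\}_{m=0}^\infty$ is a local regular supermartingale.
   Context: $(\Omega,\mathcal F)$ is a measurable space with a filtration $\mathcal F_m\subset\mathcal F_{m+1}\subset\mathcal F$, $m\ge0$, and $\mathcal F_0=\{\emptyset,\Omega\}$. All measures are probability measures; equivalent means mutually absolutely continuous. $E^P$ denotes (conditional) expectation with respect to $P$; relations between random variables hold almost surely. An adapted process $\{f_m\}_{m=0}^\infty$ is a supermartingale relative to a family of measures $M$ if $E^P|f_m|<\infty$ for $m\ge1$, $P\in M$, and $E^P\{f_m|\mathcal F_k\}\le f_k$ for $0\le k\le m$, $P\in M$. Sets of adapted non-decreasing processes starting at $0$ are partially ordered by: $g_1\preceq g_2$ iff $P(g^2_m-g^1_m\ge0)=1$ for all $m\ge1$, where $g_i=\{g^i_m\}$; (maximal) chains and maximal elements refer to $\preceq$. Regular supermartingale. Let $\{f_m,\mathcal F_m\}_{m=0}^\infty$ be a supermartingale relative to a convex set of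 equivalent measures $M$ such that $|f_m|\le\varphi$ for all $m\ge0$ and $E^Q\varphi<T<\infty$ for all $Q\in M$, with a random variable $\varphi$ and a real number $T$ not depending on $Q\in M$. It is called regular if there exists an adapted nonnegative process $\bar g^0=\{\bar g^0_m\}_{m=0}^\infty$, $\bar g^0_0=0$, $E^P\bar g^0_m<\infty$ ($m\ge1$, $P\in M$), such that for every finite family $\hat P_1,\dots,\hat P_s\in M$ satisfying $0<l\le\frac{d\hat P_i}{d\hat P_j}\le L<\infty$, $i,j=1,\dots,s$ (with $l,L$ real numbers depending on the family), the following hold. Put $\hat M_s=\{\sum_{i=1}^s\gamma_i\hat P_i:\gamma_i\ge0,\sum_{i=1}^s\gamma_i=1\}$ and let $G_s$ be the set of adapted non-decreasing processes $\{g_m\}_{m=0}^\infty$, $g_0=0$, for which $\{f_m+g_m\}_{m=0}^\infty$ is a supermartingale relative to all measures from $\hat M_s$. (i) There exist a natural number $1\le m_0<\infty$ and an $\mathcal F_{m_0-1}$-measurable nonnegative random variable $\varphi^s_{m_0}$ with $\hat P_1(\varphi^s_{m_0}>0)>0$ such that $f_{m_0-1}-E^{\hat P_i}\{f_{m_0}|\mathcal F_{m_0-1}\}\ge\varphi^s_{m_0}$, $i=1,\dots,s$. (ii) For the maximal element $g^s=\{g^s_m\}_{m=0}^\infty$ in a certain maximal chain $\tilde G_s\subseteq G_s$, $E^{\hat P_i}\{f_m+g^s_m|\mathcal F_k\}=f_k+g^s_k$ for $0\le k\le m$, $m\ge1$, $i=1,\dots,s$. (iii) $E^{\hat P_i}\{g^s_m-g^s_{m-1}|\mathcal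 F_{m-1}\}=E^{\hat P_i}\{\bar g^0_m|\mathcal F_{m-1}\}$ for $m\ge1$, $i=1,\dots,s$. Local regular supermartingale. A supermartingale $\{f_m,\mathcal F_m\}_{m=0}^\infty$ relative to $M$ with $\sup_{P\in M}E^P|f_m|<\infty$ for all $m\ge0$ is called local regular if there exists an increasing sequence of nonrandom stopping times $\tau_{k_s}=k_s<\infty$, $s=1,2,\dots$, $\lim_{s\to\infty}k_s=\infty$, such that for every $s$ the stopped process $\{f_{m\wedge\tau_{k_s}},\mathcal F_m\}_{m=0}^\infty$ is a regular supermartingale.
   Formalization: It is additionally assumed that for some m ≥ 1, P(ḡ⁰_m > 0) > 0 for all P in M; without this the claim fails, since ḡ⁰ = 0 makes f a martingale, which violates condition (i) of regularity. *)

(* Defs.v *)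
From HB Require Import structures.
From mathcomp Require Import all_boot all_order all_algebra.
From mathcomp Require Import all_classical all_reals all_analysis.
From mathcomp Require Import measurable_realfun.

Set Implicit Arguments.
Unset Strict Implicit.
Unset Printing Implicit Defensive.

Import Order.TTheory GRing.Theory Num.Theory.
Import numFieldNormedType.Exports.

Local Open Scope classical_set_scope.
Local Open Scope ring_scope.
Local Open Scope charge_scope.

Lemma pushforward_density d d' (T : measurableType d) (T' : measurableType d')
    (R : realType) (P : probability T R) (j : T -> T') (X : T -> R) :
  measurable_fun setT j -> P.-integrable setT (EFin \o X) ->
  exists Y : T' -> R, [/\ measurable_fun setT Y,
    P.-integrable setT (EFin \o (Y \o j)) &
    forall A, measurable A ->
      (\int[P]_(x in j @^-1` A) (Y (j x))%:E =
       \int[P]_(x in j @^-1` A) (X x)%:E)%E].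
Proof.
move=> mj iX.
have jmeas A : measurable A -> measurable (j @^-1` A).
  by move=> mA; rewrite -[X in measurable X]setTI; exact: mj.
pose jm : {mfun T >-> T'} := mfun_Sub (mem_set mj).
pose mu : probability T' R := distribution P jm.
pose nu0 : set T' -> \bar R := fun A => induced_charge iX (j @^-1` A).
have nu00 : nu0 set0 = 0%E by rewrite /nu0 preimage_set0 charge0.
have nu0_fin A : measurable A -> nu0 A \is a fin_num.
  by move=> /jmeas mA; exact: fin_num_measure.
have nu0_add : semi_sigma_additive nu0.
  move=> A mA tA mUA; rewrite /nu0 preimage_bigcup.
  apply: charge_semi_sigma_additive => //.
  - by move=> i; exact: jmeas.
  - apply/trivIsetP => i k _ _ ik; rewrite -preimage_setI.
    by move/trivIsetP : tA => /(_ _ _ I I ik) ->; rewrite preimage_set0.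
  - by rewrite -preimage_bigcup; exact: jmeas.
pose nuM := isCharge.Build _ T' R nu0 nu00 nu0_fin nu0_add.
pose nu : {charge set T' -> \bar R} := HB.pack nu0 nuM.
have numu : nu `<< mu.
  apply/null_content_dominatesP => A /jmeas mA muA0.
  apply: null_set_integral => //.
  by apply: measurable_funS (measurable_int P iX).
pose y := 'd nu '/d mu.
have iy : mu.-integrable setT y by exact: Radon_Nikodym_integrable.
have my : measurable_fun setT y by exact: measurable_int iy.
have fy x : y x \is a fin_num by exact: Radon_Nikodym_fin_num.
have iPy : P.-integrable setT (y \o j).
  apply/integrableP; split; first exact: measurableT_comp my mj.
  case/integrableP: iy => _; rewrite /mu /distribution ge0_integral_pushforward//.
  exact: measurableT_comp.
exists (fine \o y); split.
- exact: measurableT_comp my.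
- by apply: eq_integrable iPy => // x _ /=; rewrite fineK.
- move=> A mA; have := Radon_Nikodym_integral numu mA.
  rewrite [in X in _ = X]/mu /distribution integral_pushforward//=; last first.
    by apply: integrableS iPy => //; exact: jmeas.
  rewrite /nu /= /nu0 /induced_charge => ->.
  by apply: eq_integral => x _ /=; rewrite fineK.
Qed.

Section conditional_expectation.
Context {d : measure_display} {T : measurableType d} {R : realType}.
Implicit Types (P : probability T R) (G : set (set T)) (X Y : T -> R).

(* For a sigma-algebra [G], [<<s G >> = G] (lemma [sigma_algebra_id]), so this
   is measurability with respect to [G] itself. *)
Definition measurable_wrt G X :=
  measurable_fun [set: g_sigma_algebraType G] (X : g_sigma_algebraType G -> R).

Definition is_cond_exp P G X Y :=
  [/\ measurable_wrt G Y, P.-integrable setT (EFin \o Y) &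
      forall A, G A ->
        (\int[P]_(x in A) (Y x)%:E = \int[P]_(x in A) (X x)%:E)%E].

(* A version of E^P{X | G}; its default value 0 is used only when there is no
   version, which by [cond_expP] does not happen for integrable [X]. *)
Definition cond_exp P G X : T -> R := xget (fun=> 0) (is_cond_exp P G X).

Lemma cond_expP P G X : sigma_algebra setT G -> G `<=` measurable ->
  P.-integrable setT (EFin \o X) -> is_cond_exp P G X (cond_exp P G X).
Proof.
move=> sG Gm iX; suff [Y XY] : exists Y, is_cond_exp P G X Y.
  exact: (xgetPex _ (ex_intro _ Y XY)).
have GE : G.-sigma.-measurable = G by exact: measurable_g_measurableTypeE.
have mj : measurable_fun setT (id : T -> g_sigma_algebraType G).
  by move=> _ A; rewrite GE setTI => /Gm.
have [Y [mY iY YX]] := pushforward_density mj iX.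
by exists Y; split => // A GA; apply: YX; rewrite GE.
Qed.

End conditional_expectation.

Section supermartingales.
Context {d : measure_display} {T : measurableType d} {R : realType}.
Implicit Types (F : nat -> set (set T)) (M : set (probability T R)).
Implicit Types (f g : nat -> T -> R).

Definition filtration F :=
  [/\ forall m, sigma_algebra setT (F m),
      forall m, F m `<=` F m.+1,
      forall m, F m `<=` measurable &
      F 0%N = [set set0; setT]].

Definition adapted F f := forall m, measurable_wrt (F m) (f m).

(* Elements of [probability T R] may differ outside the measurable sets, whence
   the comparison of mixtures on measurable sets only. *)
Definition convex_measures M :=
  forall (P Q : probability T R) (t : R), M P -> M Q -> 0 <= t <= 1 ->
    exists2 N : probability T R, M N &
      forall A, measurable A -> (N A = t%:E * P A + (1 - t)%:E * Q A)%E.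

Definition equivalent_measures M :=
  forall P Q : probability T R, M P -> M Q -> P `<< Q.

Definition supermartingale F M f :=
  [/\ adapted F f,
      forall m P, (1 <= m)%N -> M P -> P.-integrable setT (EFin \o f m) &
      forall k m P, (k <= m)%N -> M P ->
        \forall x \ae P, cond_exp P (F k) (f m) x <= f k x].

Definition comparable_measures (s : nat) (P : 'I_s -> probability T R) :=
  exists l L : R, 0 < l /\ forall i j,
    \forall x \ae P j,
      (l%:E <= ('d (charge_of_finite_measure (P i)) '/d (P j)) x <= L%:E)%E.

Definition mixtures (s : nat) (P : 'I_s -> probability T R) :
    set (probability T R) :=
  [set Q | exists gamma : 'I_s -> R,
    [/\ forall i, 0 <= gamma i, \sum_i gamma i = 1 &
        forall A, measurable A -> (Q A = \sum_i (gamma i)%:E * P i A)%E]].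

Definition compensators F f (s : nat) (P : 'I_s -> probability T R) :
    set (nat -> T -> R) :=
  [set g | [/\ adapted F g,
      forall i m, \forall x \ae P i, g m x <= g m.+1 x,
      forall i, \forall x \ae P i, g 0%N x = 0 &
      supermartingale F (mixtures P) (fun m x => f m x + g m x)]].

(* Only a preorder: antisymmetry holds up to almost sure equality. *)
Definition process_le (s : nat) (P : 'I_s -> probability T R) g1 g2 :=
  forall i m, (1 <= m)%N -> \forall x \ae P i, 0 <= g2 m x - g1 m x.

End supermartingales.

Section chains.
Context {U : Type}.
Implicit Types (le : U -> U -> Prop) (G C : set U).

Definition chain_in le G C := C `<=` G /\ total_on C le.

Definition maximal_chain_in le G C :=
  chain_in le G C /\ forall C', chain_in le G C' -> C `<=` C' -> C' = C.

Definition maximal_element le C g :=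
  C g /\ forall h, C h -> le g h -> le h g.

End chains.

Section regular_supermartingales.
Context {d : measure_display} {T : measurableType d} {R : realType}.
Implicit Types (F : nat -> set (set T)) (M : set (probability T R)).
Implicit Types (f g gbar : nat -> T -> R).

(* The family P_1, ..., P_s, s >= 1, is indexed from 0: P_1 is [P ord0]. *)
Definition regular_for F f gbar (s : nat) (P : 'I_s.+1 -> probability T R) :=
  (exists (m0 : nat) (phi : T -> R),
    [/\ (1 <= m0)%N,
        measurable_wrt (F m0.-1) phi,
        forall i, \forall x \ae P i, 0 <= phi x,
        (0 < P ord0 [set x | (0 < phi x)%R])%E &
        forall i, \forall x \ae P i,
          phi x <= f m0.-1 x - cond_exp (P i) (F m0.-1) (f m0) x]) /\
  (exists C g,
    [/\ maximal_chain_in (process_le P) (compensators F f P) C,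
        maximal_element (process_le P) C g,
        forall i k m, (k <= m)%N -> (1 <= m)%N -> \forall x \ae P i,
          cond_exp (P i) (F k) (fun y => f m y + g m y) x = f k x + g k x &
        forall i m, (1 <= m)%N -> \forall x \ae P i,
          cond_exp (P i) (F m.-1) (fun y => g m y - g m.-1 y) x
          = cond_exp (P i) (F m.-1) (gbar m) x]).

Definition regular F M f :=
  [/\ convex_measures M, equivalent_measures M, supermartingale F M f,
      exists (phi : T -> R) (t : R),
        [/\ measurable_fun setT phi,
            forall m P, M P -> \forall x \ae P, `|f m x| <= phi x &
            forall Q : probability T R, M Q ->
              (\int[Q]_x (phi x)%:E < t%:E)%E] &
      exists gbar : nat -> T -> R,
        [/\ adapted F gbar,
            forall m P, M P -> \forall x \ae P, 0 <= gbar m x,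
            forall P, M P -> \forall x \ae P, gbar 0%N x = 0,
            forall m P, (1 <= m)%N -> M P ->
              P.-integrable setT (EFin \o gbar m) &
            forall (s : nat) (P : 'I_s.+1 -> probability T R),
              (forall i, M (P i)) -> comparable_measures P ->
              regular_for F f gbar P]].

Definition sup_L1_finite M f :=
  forall m, (ereal_sup [set \int[P]_x (`|f m x|)%:E | P in M] < +oo)%E.

(* Only the nonrandom stopping times tau = k are needed. *)
Definition stopped f (k : nat) : nat -> T -> R := fun m => f (minn m k).

Definition local_regular F M f :=
  [/\ supermartingale F M f, sup_L1_finite M f &
      exists k : nat -> nat,
        [/\ {homo k : s t / (s < t)%N}, k s @[s --> \oo] --> \oo &
            forall s, regular F M (stopped f (k s))]].

End regular_supermartingales.

(* Main.v *)
Require Import Defs.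
From HB Require Import structures.
From mathcomp Require Import all_boot all_order all_algebra.
From mathcomp Require Import all_classical all_reals all_analysis.
From mathcomp Require Import measurable_realfun.
From mathcomp Require Import lra.

Set Implicit Arguments.
Unset Strict Implicit.
Unset Printing Implicit Defensive.

Import Order.TTheory GRing.Theory Num.Theory.
Import numFieldNormedType.Exports.

Local Open Scope classical_set_scope.
Local Open Scope ring_scope.

(** The whole argument rests on the partial sums [S_m] of [gbar_1, gbar_2, ...].
    The drift identity says precisely that [f + S] is a martingale under every
    measure of [M] ([compensated_step]), so [S] is a nondecreasing process that
    compensates [f] exactly, and it does so for all measures at once.

    Stop at a deterministic time [K], at or after an index [m0] such that
    [gbar_m0] is positive with positive probability. A martingale stopped at a
    deterministic time is a martingale ([is_cond_exp_stopped]), and the stopped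
    process is dominated by the finite sum of the [|f_j|], [j <= K], whose expectations are
    bounded uniformly in [M] ([stopped_envelope]). It remains to treat a finite
    family [P_0, ..., P_s] of measures of [M].

    - Strict decrease. Each version of the conditional expectation of [gbar_m0]
      under [P_i] can vanish only where [gbar_m0] does, up to null sets. The
      measures have the same null sets, so the minimum of these finitely many
      versions is still positive on a set of positive measure, and it bounds the
      drift at time [m0] from below ([common_positive_lower_bound]).

    - The maximal compensator. The identity defining conditional expectations is
      linear in the measure, so [f + S] stopped at [K] is a martingale under all
      mixtures ([is_cond_exp_mixture]) and the stopped [S] is a compensator. It
      is maximal among all compensators: if [h] is a larger one, the expectation
      of [f_m + h_m] is at most that of [f_0], which is that of [f_m + S_m], so
      [h_m - S_m >= 0] has nonpositive expectation and vanishes almost surely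
      ([martingale_compensator_maximal]). By Zorn's lemma the stopped [S] lies in
      a maximal chain ([exists_maximal_chain]), where it is a fortiori maximal.

    - The increments of the stopped [S] are the [gbar_m], cut off after [K]; the
      process required by regularity is [gbar] with this cut-off
      ([regular_for_drift]). *)

(** * Null sets, and integrals under mixtures *)

Section almost_everywhere_integrals.
Context {d : measure_display} {T : measurableType d} {R : realType}.
Implicit Types (P Q : probability T R) (D : set T) (X Z : T -> R).

Lemma ae_dominated P Q (S : T -> Prop) : P `<< Q ->
  (\forall x \ae Q, S x) -> \forall x \ae P, S x.
Proof.
move=> /null_content_dominatesP PQ [N [mN N0 SN]].
by exists N; split => //; exact: PQ.
Qed.

Lemma integral_ge0_ae P D X : measurable D -> measurable_fun setT X ->
  (\forall x \ae P, D x -> 0 <= X x) -> (0 <= \int[P]_(x in D) (X x)%:E)%E.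
Proof.
move=> mD mX X0.
have mXD : measurable_fun D X by exact: measurable_funTS.
rewrite (@ae_eq_integral _ _ _ _ _ (fun x => `|X x|%:E))//.
- by apply: integral_ge0 => x _; rewrite lee_fin.
- exact/measurable_EFinP.
- by apply/measurable_EFinP; exact: measurableT_comp.
- by apply: filterS X0 => x X0 Dx; rewrite ger0_norm ?X0.
Qed.

(** The one tool for passing from integrals to almost sure statements: applied
    to a difference on the set where it has the wrong sign, it gives the
    comparison of conditional expectations; applied on the whole space, the
    maximality of the martingale compensator. *)
Lemma ae_eq0_of_integral_ge0 P D Z : measurable D ->
  P.-integrable setT (EFin \o Z) -> (\forall x \ae P, D x -> Z x <= 0) ->
  (0 <= \int[P]_(x in D) (Z x)%:E)%E -> \forall x \ae P, D x -> Z x = 0.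
Proof.
move=> mD iZ Z0 int0.
have mZ : measurable_fun D (EFin \o Z).
  by apply: measurable_funTS; exact: measurable_int iZ.
have iZD : P.-integrable D (EFin \o Z) by exact: integrableS iZ.
have absE : (\int[P]_(x in D) `|(EFin \o Z) x| = - \int[P]_(x in D) (Z x)%:E)%E.
  rewrite -integralN; last first.
    by apply: fin_num_adde_defl; rewrite fin_numN; exact: integrable_neg_fin_num.
  apply: ae_eq_integral => //.
  - exact: measurableT_comp.
  - by apply: measurableT_comp => //.
  - by apply: filterS Z0 => x Z0 Dx /=; rewrite ler0_norm ?Z0.
have /(ae_eq_integral_abs P mD mZ) : (\int[P]_(x in D) `|(EFin \o Z) x| = 0)%E.
  by apply/eqP; rewrite eq_le integral_ge0 ?andbT ?absE ?oppe_le0.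
by apply: filterS => x /[apply] -[].
Qed.

Lemma integral_mixture_ge0 s (P : 'I_s.+1 -> probability T R)
    (Q : probability T R) (gamma : 'I_s.+1 -> R) D (h : T -> \bar R) :
  (forall i, 0 <= gamma i) ->
  (forall A, measurable A -> Q A = \sum_i (gamma i)%:E * P i A)%E ->
  measurable D -> measurable_fun D h -> (forall x, D x -> 0 <= h x)%E ->
  (\int[Q]_(x in D) h x = \sum_i (gamma i)%:E * \int[P i]_(x in D) h x)%E.
Proof.
move=> g0 QE mD mh h0.
(* [msum] adds up sequences of measures, hence the reindexing by [inord]. *)
pose m_ (n : nat) : {measure set T -> \bar R} :=
  mscale (NngNum (g0 (inord n))) (P (inord n)).
rewrite (eq_measure_integral (msum m_ s.+1)); last first.
  move=> A mA _; rewrite [LHS]QE// /msum; apply: eq_bigr => i _.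
  by rewrite /m_ /mscale/= inord_val.
rewrite ge0_integral_measure_sum//; apply: eq_bigr => i _.
by rewrite /m_ ge0_integral_mscale//= inord_val.
Qed.

Lemma integrable_mixture s (P : 'I_s.+1 -> probability T R)
    (Q : probability T R) X :
  mixtures P Q -> (forall i, (P i).-integrable setT (EFin \o X)) ->
  Q.-integrable setT (EFin \o X).
Proof.
move=> [gamma [g0 _ QE]] iX.
have mX : measurable_fun setT (EFin \o X) by exact: measurable_int (iX ord0).
apply/integrableP; split => //.
rewrite (integral_mixture_ge0 g0 QE)//; last exact: measurableT_comp.
apply/lte_sum_pinfty => i _.
by case/integrableP: (iX i) => _ fin; apply: lte_mul_pinfty; rewrite ?lee_fin.
Qed.

(** Splitting into positive and negative parts reduces this to
    [integral_mixture_ge0]; integrability under each vertex rules out any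
    indeterminate difference when the parts are recombined. *)
Lemma integral_mixture s (P : 'I_s.+1 -> probability T R)
    (Q : probability T R) (gamma : 'I_s.+1 -> R) D X :
  (forall i, 0 <= gamma i) ->
  (forall A, measurable A -> Q A = \sum_i (gamma i)%:E * P i A)%E ->
  measurable D -> (forall i, (P i).-integrable setT (EFin \o X)) ->
  (\int[Q]_(x in D) (X x)%:E =
   \sum_i (gamma i)%:E * \int[P i]_(x in D) (X x)%:E)%E.
Proof.
move=> g0 QE mD iX.
have iXD i : (P i).-integrable D (EFin \o X) by exact: integrableS (iX i).
have mX : measurable_fun D (EFin \o X) by exact: measurable_int (iXD ord0).
rewrite integralE !(integral_mixture_ge0 g0 QE)//.
2: exact: measurable_funeneg.
2: exact: measurable_funepos.
have posE i : (\int[P i]_(x in D) (EFin \o X)^\+ x)%E \is a fin_num.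
  exact: (integrable_pos_fin_num mD (iXD i)).
have negE i : (\int[P i]_(x in D) (EFin \o X)^\- x)%E \is a fin_num.
  exact: (integrable_neg_fin_num mD (iXD i)).
rewrite -fin_num_sumeN => [|i _]; last by rewrite fin_numM.
rewrite -big_split; apply: eq_bigr => i _ /=.
rewrite [in RHS]integralE [RHS]muleBr//; exact: fin_num_adde_defr (posE i).
Qed.

End almost_everywhere_integrals.

(** * Comparison of conditional expectations *)

Section versions_of_conditional_expectation.
Context {d : measure_display} {T : measurableType d} {R : realType}.
Implicit Types (P Q : probability T R) (G H : set (set T)) (X Y Z : T -> R).

Lemma measurable_wrtS G H X :
  G `<=` H -> measurable_wrt G X -> measurable_wrt H X.
Proof.
move=> GH mX _ B mB; have := mX measurableT B mB.
exact: (sub_sigma_algebra2 GH).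
Qed.

Lemma measurable_wrt_measurable G X :
  G `<=` measurable -> measurable_wrt G X -> measurable_fun setT X.
Proof.
move=> GM mX _ B mB; have := mX measurableT B mB.
by apply: smallest_sub => //; exact: sigma_algebra_measurable.
Qed.

Lemma measurable_wrt_lt0 G X : sigma_algebra setT G -> measurable_wrt G X ->
  G [set x | X x < 0].
Proof.
move=> sG mX; have := mX measurableT `]-oo, 0[%classic (measurable_itv _).
by rewrite measurable_g_measurableTypeE// setTI.
Qed.

Lemma measurable_wrt_le0 G X : sigma_algebra setT G -> measurable_wrt G X ->
  G [set x | X x <= 0].
Proof.
move=> sG mX; have := mX measurableT `]-oo, 0]%classic (measurable_itv _).
by rewrite measurable_g_measurableTypeE// setTI.
Qed.

(** The set where [Y' < Y] is in [G], so the integrals of [Y' - Y] and [X' - X]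
    over it agree; the former is nonpositive, the latter nonnegative. With
    [X = X'] this is the almost sure uniqueness of versions. *)
Lemma is_cond_exp_le P G X X' Y Y' : sigma_algebra setT G ->
  G `<=` measurable -> P.-integrable setT (EFin \o X) ->
  P.-integrable setT (EFin \o X') ->
  is_cond_exp P G X Y -> is_cond_exp P G X' Y' ->
  (\forall x \ae P, X x <= X' x) -> \forall x \ae P, Y x <= Y' x.
Proof.
move=> sG GM iX iX' [mY iY YX] [mY' iY' YX'] XX'.
pose Z := Y' \- Y; pose D := [set x | Z x < 0].
have GD : G D by apply: measurable_wrt_lt0 => //; exact: measurable_funB.
have mD : measurable D by exact: GM.
have iZ : P.-integrable setT (EFin \o Z) by exact: (integrableB measurableT iY' iY).
have : \forall x \ae P, D x -> Z x = 0.
  apply: ae_eq0_of_integral_ge0 => //.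
    by apply: aeW => x /ltW.
  rewrite integralB_EFin//; try exact: integrableS iY; try exact: integrableS iY'.
  rewrite YX// YX'// -integralB_EFin//; try exact: integrableS iX;
    try exact: integrableS iX'.
  apply: (@integral_ge0_ae _ _ _ P D (X' \- X)) => //.
    have : measurable_fun setT (EFin \o (X' \- X)).
      exact: measurable_int (integrableB measurableT iX' iX).
    by move/measurable_EFinP.
  by apply: filterS XX' => x XX' _; rewrite subr_ge0.
apply: filterS => x; rewrite /D /Z /= => Z0.
rewrite leNgt -subr_lt0; apply/negP => YY.
by have := YY; rewrite Z0 ?ltxx.
Qed.

Lemma cond_exp_eq P G X Y : sigma_algebra setT G -> G `<=` measurable ->
  P.-integrable setT (EFin \o X) -> is_cond_exp P G X Y ->
  \forall x \ae P, cond_exp P G X x = Y x.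
Proof.
move=> sG GM iX XY; have XC := cond_expP sG GM iX.
have le_refl : \forall x \ae P, X x <= X x by exact: aeW.
apply: filterS2 (is_cond_exp_le sG GM iX iX XC XY le_refl)
  (is_cond_exp_le sG GM iX iX XY XC le_refl) => x ? ?.
by apply/eqP; rewrite eq_le; apply/andP.
Qed.

(** One version common to all vertices serves every mixture, because the
    identity that defines it is linear in the measure. Conditional expectations
    that differ from vertex to vertex do not combine linearly. *)
Lemma is_cond_exp_mixture s (P : 'I_s.+1 -> probability T R) Q G X Y :
  G `<=` measurable -> mixtures P Q ->
  (forall i, (P i).-integrable setT (EFin \o X)) ->
  (forall i, is_cond_exp (P i) G X Y) -> is_cond_exp Q G X Y.
Proof.
move=> GM PQ iX XY.
have iY i : (P i).-integrable setT (EFin \o Y) by have [] := XY i.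
split; [by have [] := XY ord0|exact: integrable_mixture iY|].
have [gamma [g0 _ QE]] := PQ => A GA; have mA := GM _ GA.
rewrite !(integral_mixture g0 QE)//; apply: eq_bigr => i _.
by have [_ _ ->] := XY i.
Qed.

(** The bound is the minimum of the conditional expectations. Where the one
    under [P i] is nonpositive, [X] has nonpositive integral, so [X = 0] there
    almost surely under [P i], hence under every [P j]. If the minimum were
    almost surely nonpositive, [X] would therefore vanish almost surely. *)
Lemma common_positive_lower_bound s (P : 'I_s.+1 -> probability T R) G X :
  sigma_algebra setT G -> G `<=` measurable ->
  (forall i j, P i `<< P j) ->
  (forall i, (P i).-integrable setT (EFin \o X)) ->
  (forall i, \forall x \ae P i, 0 <= X x) ->
  (0 < P ord0 [set x | (0 < X x)%R])%E ->
  exists phi : T -> R,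
    [/\ measurable_wrt G phi,
        forall i, \forall x \ae P i, 0 <= phi x,
        (0 < P ord0 [set x | (0 < phi x)%R])%E &
        forall i, \forall x \ae P i, phi x <= cond_exp (P i) G X x].
Proof.
move=> sG GM PP iX X0 PX.
pose Y i := cond_exp (P i) G X.
have YX i : is_cond_exp (P i) G X (Y i) by exact: cond_expP.
pose phi x := \big[Num.min/Y ord0 x]_(i < s.+1) Y i x.
have mphi : measurable_wrt G phi.
  rewrite /measurable_wrt /phi; elim: (index_enum _) => [|i r IH].
    under eq_fun do rewrite big_nil.
    by have [] := YX ord0.
  under eq_fun do rewrite big_cons.
  by apply: measurable_minr => //; have [] := YX i.
have mX : measurable_fun setT X.
  by apply/measurable_EFinP; exact: measurable_int (iX ord0).
have Y0 i : \forall x \ae P i, 0 <= Y i x.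
  apply: (@is_cond_exp_le (P i) G (cst 0) X (cst 0)) => //.
  - exact: (finite_measure_integrable_cst (P i) _ measurableT).
  - split => //; first exact: measurable_cst.
    exact: (finite_measure_integrable_cst (P i) _ measurableT).
have X_le0 i : \forall x \ae P i, Y i x <= 0 -> X x <= 0.
  have [mY iY YXE] := YX i.
  pose D := [set x | Y i x <= 0].
  have GD : G D by exact: measurable_wrt_le0.
  have mD := GM _ GD.
  have : \forall x \ae P i, D x -> - X x = 0.
    apply: (@ae_eq0_of_integral_ge0 _ _ _ (P i) D (\- X)) => //.
    - exact: (integrableN (iX i)).
    - by apply: filterS (X0 i) => x Xx _; rewrite oppr_le0.
    - have -> : (\int[P i]_(x in D) ((\- X) x)%:E
                = \int[P i]_(x in D) ((\- Y i) x)%:E)%E.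
        under eq_integral do rewrite EFinN.
        under [RHS]eq_integral do rewrite EFinN.
        rewrite !integralN ?YXE//; apply: fin_num_adde_defl;
        rewrite fin_numN; apply: integrable_neg_fin_num => //.
        + exact: integrableS iY.
        + exact: integrableS (iX i).
      by apply: integral_ge0 => x /=; rewrite lee_fin oppr_ge0.
  by apply: filterS => x XD /XD /eqP; rewrite oppr_eq0 => /eqP ->.
exists phi; split => //.
- move=> i; have : \forall x \ae P i, forall j, 0 <= Y j x.
    by apply: filter_forall => j; exact: ae_dominated (Y0 j).
  by apply: filterS => x Yx; exact: le_bigmin.
- have mpos Z : measurable_fun setT Z -> measurable [set x | 0 < Z x].
    move=> mZ; have := mZ measurableT `]0, +oo[%classic (measurable_itv _).
    rewrite setTI; congr (measurable _).
    by apply/seteqP; split => x /=; rewrite in_itv/= andbT.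
  have mphiT := measurable_wrt_measurable GM mphi.
  rewrite lt0e measure_ge0 andbT; apply/negP => /eqP phi0.
  suff PX0 : P ord0 [set x | 0 < X x] = 0%E by rewrite PX0 ltxx in PX.
  have phi_le0 : \forall x \ae P ord0, phi x <= 0.
    exists [set x | 0 < phi x]; split => //; first exact: mpos.
    by move=> x /= /negP; rewrite -ltNge.
  have X_le0' : \forall x \ae P ord0, forall i, Y i x <= 0 -> X x <= 0.
    by apply: filter_forall => i; exact: ae_dominated (X_le0 i).
  have : \forall x \ae P ord0, X x <= 0.
    apply: filterS2 phi_le0 X_le0' => x /bigmin_leP[/[swap]|[i _ /[swap]]]; exact.
  case=> N [mN N0 XN].
  apply: (subset_measure0 (B := N)) => //; first exact: mpos.
  by apply: subset_trans XN => x /=; rewrite ltNge => /negP.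
- by move=> i; apply: aeW => x; exact: bigmin_le.
Qed.

End versions_of_conditional_expectation.

(** * Maximal chains through a given element *)

Section maximal_chains.
Context {U : Type}.
Implicit Types (le : U -> U -> Prop) (G C : set U).

(** Hausdorff's maximal principle for a reflexive element of an arbitrary
    relation. *)
Lemma exists_maximal_chain le G g : G g -> le g g ->
  exists2 C, maximal_chain_in le G C & C g.
Proof.
move=> Gg gg.
(* Zorn's lemma also asks for an upper bound of the empty family, whose union
   does not contain [g]; so it is applied to the sets that become chains once
   [g] is added. *)
have [Fs FsP totF|A [chA maxA]] :=
    @Zorn_bigcup U [set C | chain_in le G (C `|` [set g])].
  split.
    move=> x [[C FC Cx]|->//]; have [+ _] := FsP _ FC.
    by apply; left.
  have chE C x y : Fs C -> (C `|` [set g]) x -> (C `|` [set g]) y ->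
    le x y \/ le y x by move=> /FsP[_]; exact.
  move=> x y [[C FC Cx]|->] [[D FD Dy]|->].
  - have [CD|DC] := totF _ _ FC FD.
    + by apply: (chE D) => //; left; [exact: CD|].
    + by apply: (chE C) => //; left; [|exact: DC].
  - by apply: (chE C) => //; [left|right].
  - by apply: (chE D) => //; [right|left].
  - by left.
exists (A `|` [set g]); last by right.
split=> // C chC AC; apply: contrapT => CA.
apply: (maxA C); last first.
  by rewrite /= (_ : C `|` [set g] = C)//; apply/setUidPl => x ->; apply: AC; right.
split.
  by move=> x Ax; apply: AC; left.
by move=> CsubA; apply: CA; apply/seteqP; split => // x /CsubA; left.
Qed.

End maximal_chains.

(** * Stopping at a deterministic time, and the maximality of martingales *)

Section stopped_martingales.
Context {d : measure_display} {T : measurableType d} {R : realType}.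
Implicit Types (P Q : probability T R) (F : nat -> set (set T)).
Implicit Types (M : set (probability T R)) (f g h : nat -> T -> R).

Lemma filtration_le F k m : filtration F -> (k <= m)%N -> F k `<=` F m.
Proof.
move=> [_ FS _ _]; elim: m => [|m IH]; first by rewrite leqn0 => /eqP ->.
rewrite leq_eqVlt => /predU1P[-> //|/IH km]; exact: subset_trans (FS m).
Qed.

Lemma adapted_stopped F h K : filtration F -> adapted F h ->
  adapted F (stopped h K).
Proof.
move=> FF ah m; apply: measurable_wrtS (ah (minn m K)).
exact: (filtration_le FF (geq_minl _ _)).
Qed.

Lemma integrableD_fin P (X Y : T -> R) :
  P.-integrable setT (EFin \o X) -> P.-integrable setT (EFin \o Y) ->
  P.-integrable setT (EFin \o (X \+ Y)).
Proof. by move=> iX iY; exact: (integrableD measurableT iX iY). Qed.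

Lemma integralD_fin P A (X Y : T -> R) : measurable A ->
  P.-integrable setT (EFin \o X) -> P.-integrable setT (EFin \o Y) ->
  (\int[P]_(x in A) (X x + Y x)%:E =
   \int[P]_(x in A) (X x)%:E + \int[P]_(x in A) (Y x)%:E)%E.
Proof.
move=> mA iX iY.
by rewrite -(integralD_EFin mA)//; [exact: integrableS iX|exact: integrableS iY].
Qed.

(** Up to time [K] the one-step identities telescope; after it the process no
    longer moves. *)
Lemma is_cond_exp_stopped F P h : filtration F -> adapted F h ->
  (forall m, P.-integrable setT (EFin \o h m)) ->
  (forall m A, F m A ->
    (\int[P]_(x in A) (h m.+1 x)%:E = \int[P]_(x in A) (h m x)%:E)%E) ->
  forall K k m, (k <= m)%N ->
  is_cond_exp P (F k) (stopped h K m) (stopped h K k).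
Proof.
move=> FF ah ih step K k m km.
split; [exact: adapted_stopped|exact: ih|move=> A FkA].
have step' n p : (n <= p)%N -> F n A ->
    (\int[P]_(x in A) (h p x)%:E = \int[P]_(x in A) (h n x)%:E)%E.
  elim: p => [|p IH]; first by rewrite leqn0 => /eqP ->.
  rewrite leq_eqVlt => /predU1P[-> //|np] FnA.
  rewrite (step p A) ?IH//.
  exact: (@filtration_le F n p FF np).
rewrite /stopped; have [kK|Kk] := leqP k K.
  by rewrite [RHS](step' k)// leq_min km.
by rewrite (minn_idPr _)// (leq_trans (ltnW Kk)).
Qed.

Lemma supermartingale_stopped F M f K : filtration F -> supermartingale F M f ->
  (forall m P, M P -> P.-integrable setT (EFin \o f m)) ->
  supermartingale F M (stopped f K).
Proof.
move=> FF [af _ sf] intf; have [sF _ FM _] := FF.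
split => [|m P _ MP|k m P km MP]; [exact: adapted_stopped|exact: intf|].
have [kK|Kk] := leqP k K.
  by rewrite /stopped (minn_idPl kK); apply: sf => //; rewrite leq_min km.
have -> : stopped f K m = stopped f K k.
  by rewrite /stopped !(minn_idPr _)// ?(ltnW Kk)// (leq_trans (ltnW Kk)).
have CE : is_cond_exp P (F k) (stopped f K k) (stopped f K k).
  by split => //; [exact: adapted_stopped|exact: intf].
by apply: filterS (cond_exp_eq (sF k) (FM k) (intf _ _ MP) CE) => x ->.
Qed.

Lemma mixtures_vertex s (P : 'I_s -> probability T R) i : mixtures P (P i).
Proof.
exists (fun j => (j == i)%:R); split => [j|| A _]; first exact: ler0n.
  by rewrite (bigD1 i)//= eqxx big1 ?addr0// => j /negbTE ->.
rewrite (bigD1 i)//= eqxx mul1e big1 ?adde0// => j /negbTE ->.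
by rewrite mul0e.
Qed.

(** Both [f + g] and [f + h] start at [f_0]; the expectation of the first is
    constant and that of the second does not increase, so a nonnegative [h - g]
    must have zero expectation. *)
Lemma martingale_compensator_maximal F f s (P : 'I_s -> probability T R) g h :
  filtration F ->
  (forall i m, is_cond_exp (P i) (F 0%N)
     (fun x => f m x + g m x) (fun x => f 0%N x + g 0%N x)) ->
  compensators F f P g -> compensators F f P h -> process_le P g h ->
  process_le P h g.
Proof.
move=> FF gM [_ _ g0 [_ ig _]] [_ _ h0 [_ ih sh]] gh i m m1.
have [sF _ FM _] := FF.
pose u x := f m x + g m x; pose v x := f m x + h m x.
have iu : (P i).-integrable setT (EFin \o u).
  by apply: ig => //; exact: mixtures_vertex.
have iv : (P i).-integrable setT (EFin \o v).
  by apply: ih => //; exact: mixtures_vertex.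
have [_ iu0 Eu] := gM i m.
have [_ iC Ev] := cond_expP (sF 0%N) (FM 0%N) iv.
have FT : F 0%N setT by have [_ _ _ ->] := FF; right.
have iuv : (P i).-integrable setT (EFin \o (u \- v)).
  exact: (integrableB measurableT iu iv).
have : \forall x \ae P i, setT x -> (u \- v) x = 0.
  apply: ae_eq0_of_integral_ge0 => //.
    by apply: filterS (gh i m m1) => x + _; rewrite /u /v /=; lra.
  rewrite integralB_EFin// -Ev// -Eu// -integralB_EFin//.
  apply: (@integral_ge0_ae _ _ _ (P i) setT
    ((fun x => f 0%N x + g 0%N x) \- cond_exp (P i) (F 0%N) v)) => //.
    apply/measurable_EFinP.
    exact: measurable_int (integrableB measurableT iu0 iC).
  have sh0 := sh 0%N m (P i) (leq0n m) (mixtures_vertex P i).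
  apply: filterS3 (g0 i) (h0 i) sh0 => x /= -> -> + _.
  by rewrite subr_ge0.
by apply: filterS => x /(_ I); rewrite /u /v /=; lra.
Qed.

End stopped_martingales.

(** * The process compensated by its drift *)

Section compensation.
Context {d : measure_display} {T : measurableType d} {R : realType}.
Implicit Types (P Q : probability T R) (F : nat -> set (set T)).
Implicit Types (M : set (probability T R)) (f gbar : nat -> T -> R).

Definition drift_sum gbar (n : nat) (x : T) : R := \sum_(j < n) gbar j.+1 x.

Lemma drift_sumS gbar n x :
  drift_sum gbar n.+1 x = drift_sum gbar n x + gbar n.+1 x.
Proof. exact: big_ord_recr. Qed.

Lemma adapted_drift_sum F gbar : filtration F ->
  (forall m, (1 <= m)%N -> measurable_wrt (F m) (gbar m)) ->
  adapted F (drift_sum gbar).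
Proof.
move=> FF mg n; apply: measurable_sum => j.
exact: measurable_wrtS (filtration_le FF (ltn_ord j)) (mg _ _).
Qed.

Lemma integrable_drift_sum P gbar :
  (forall m, (1 <= m)%N -> P.-integrable setT (EFin \o gbar m)) ->
  forall n, P.-integrable setT (EFin \o drift_sum gbar n).
Proof.
move=> ig n; apply: (eq_integrable measurableT
    (fun x => (\sum_(j < n) (gbar j.+1 x)%:E)%E)).
  by move=> x _ /=; rewrite sumEFin.
by apply: integrable_sum => // j _; exact: (ig j.+1 isT).
Qed.

(** The drift identity integrated over [A], with the sum of the earlier terms
    added on both sides. *)
Lemma compensated_step F P f gbar m : filtration F ->
  (forall m, P.-integrable setT (EFin \o f m)) ->
  (forall m, (1 <= m)%N -> P.-integrable setT (EFin \o gbar m)) ->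
  (\forall x \ae P,
    f m x - cond_exp P (F m) (f m.+1) x = cond_exp P (F m) (gbar m.+1) x) ->
  forall A, F m A ->
  (\int[P]_(x in A) (f m.+1 x + drift_sum gbar m.+1 x)%:E =
   \int[P]_(x in A) (f m x + drift_sum gbar m x)%:E)%E.
Proof.
move=> FF intf ig fg A FA; have [sF _ FM _] := FF.
have mA := FM _ _ FA; have iS := integrable_drift_sum ig.
have [_ iC1 E1] := cond_expP (sF m) (FM m) (intf m.+1).
have [_ iC2 E2] := cond_expP (sF m) (FM m) (ig m.+1 isT).
under eq_integral do rewrite drift_sumS addrCA.
rewrite !integralD_fin//; last 2 first.
- exact: (ig m.+1 isT).
- exact: (integrableD_fin (intf _) (ig m.+1 isT)).
rewrite -E1// -E2// addeC -integralD_fin//.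
congr (_ + _)%E.
have mC : P.-integrable setT (EFin \o
  (cond_exp P (F m) (f m.+1) \+ cond_exp P (F m) (gbar m.+1))).
  exact: integrableD_fin.
apply: ae_eq_integral => //.
- by apply: measurable_funTS; exact: measurable_int mC.
- by apply: measurable_funTS; exact: measurable_int (intf m).
- by apply: filterS fg => x <- _; rewrite addrC subrK.
Qed.

Lemma stopped_drift_sum_increment gbar K m x : (1 <= m)%N ->
  stopped (drift_sum gbar) K m x - stopped (drift_sum gbar) K m.-1 x =
  if (m <= K)%N then gbar m x else 0.
Proof.
case: m => // m _; rewrite /stopped/=; case: ltnP => mK.
  by rewrite (minn_idPl mK) drift_sumS addrC addKr.
by rewrite (minn_idPr (leqW mK)) subrr.
Qed.

(** The stopped process takes only the values [f_0, ..., f_K], so the sum of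
    their absolute values dominates it at all times. *)
Lemma stopped_envelope M f K : sup_L1_finite M f ->
  (forall m P, M P -> P.-integrable setT (EFin \o f m)) ->
  (forall m, measurable_fun setT (f m)) ->
  exists (phi : T -> R) (t : R),
    [/\ measurable_fun setT phi,
        forall m P, M P -> \forall x \ae P, `|stopped f K m x| <= phi x &
        forall Q : probability T R, M Q -> (\int[Q]_x (phi x)%:E < t%:E)%E].
Proof.
move=> fsup intf mf.
pose sup_ m := ereal_sup [set \int[P]_x (`|f m x|)%:E | P in M]%E.
exists (fun x => \sum_(j < K.+1) `|f j x|), (\sum_(j < K.+1) fine (sup_ j) + 1).
split.
- by apply: measurable_sum => j; exact: measurableT_comp.
- move=> m P MP; apply: aeW => x.
  have mK : (minn m K < K.+1)%N by rewrite ltnS geq_minr.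
  rewrite (bigD1 (Ordinal mK))//= lerDl; exact: sumr_ge0.
- move=> Q MQ; under eq_integral do rewrite -sumEFin.
  rewrite integral_sum//; last by move=> j; exact: integrable_norm (intf j Q MQ).
  apply: (@le_lt_trans _ _ (\sum_(j < K.+1) fine (sup_ j))%:E); last first.
    by rewrite lte_fin ltrDl.
  rewrite -sumEFin; apply: lee_sum => j _.
  have le_sup : (\int[Q]_x (`|f j x|)%:E <= sup_ j)%E.
    by apply: ereal_sup_ubound; exists Q.
  rewrite fineK// ge0_fin_numE; first exact: fsup.
  by apply: le_trans le_sup; apply: integral_ge0 => x _; rewrite lee_fin.
Qed.

(** The hypothesis on [gbar'] says that it is [gbar] cut off after [K]. The
    compensator exhibited is the stopped sum of the drifts. *)
Lemma regular_for_drift F M f gbar gbar' K m0 s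
    (P : 'I_s.+1 -> probability T R) :
  filtration F -> equivalent_measures M -> adapted F f ->
  (forall m P, M P -> P.-integrable setT (EFin \o f m)) ->
  (forall m, (1 <= m)%N -> measurable_wrt (F m) (gbar m)) ->
  (forall m P, (1 <= m)%N -> M P -> \forall x \ae P, 0 <= gbar m x) ->
  (forall m P, (1 <= m)%N -> M P -> P.-integrable setT (EFin \o gbar m)) ->
  (forall m P, (1 <= m)%N -> M P -> \forall x \ae P,
    f m.-1 x - cond_exp P (F m.-1) (f m) x = cond_exp P (F m.-1) (gbar m) x) ->
  (1 <= m0 <= K)%N ->
  (forall P, M P -> (0 < P [set x | (0 < gbar m0 x)%R])%E) ->
  (forall m x, (1 <= m)%N -> gbar' m x = if (m <= K)%N then gbar m x else 0) ->
  (forall i, M (P i)) -> regular_for F (stopped f K) gbar' P.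
Proof.
move=> FF eqM af intf mg g0 ig fg /andP[m01 m0K] gpos g'E MP.
have [sF _ FM _] := FF.
split.
  have [||||phi [mphi phi0 phipos phile]] :=
    @common_positive_lower_bound _ _ _ s P (F m0.-1) (gbar m0) (sF _) (FM _).
  - by move=> i j; exact: eqM.
  - by move=> i; exact: ig.
  - by move=> i; exact: g0.
  - exact: gpos.
  exists m0, phi; split=> // i; rewrite /stopped (minn_idPl m0K).
  rewrite (minn_idPl (leq_trans (leq_pred _) m0K)).
  by apply: filterS2 (phile i) (fg m0 (P i) m01 (MP i)) => x + ->.
pose S := drift_sum gbar.
pose h m x := f m x + S m x.
have aS : adapted F S by exact: adapted_drift_sum.
have iS m i : (P i).-integrable setT (EFin \o S m).
  by apply: integrable_drift_sum => n n1; exact: ig.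
have ih m i : (P i).-integrable setT (EFin \o h m).
  by apply: integrableD_fin => //; exact: intf.
have ah : adapted F h by move=> m; exact: (measurable_funD (af m) (aS m)).
have hM i k m : (k <= m)%N ->
    is_cond_exp (P i) (F k) (stopped h K m) (stopped h K k).
  apply: (is_cond_exp_stopped FF ah) => // n A FA.
  apply: (compensated_step FF) => //.
  - by move=> p; exact: intf.
  - by move=> p p1; exact: ig.
  - exact: (fg n.+1).
pose g := stopped S K.
have gG : compensators F (stopped f K) P g.
  split.
  - exact: adapted_stopped.
  - move=> i m.
    have /= := stopped_drift_sum_increment gbar K _ (ltn0Sn m).
    have [mK|_] := leqP m.+1 K => incr.
      by apply: filterS (g0 m.+1 (P i) isT (MP i)) => x; rewrite -incr subr_ge0.
    by apply: aeW => x; rewrite -subr_ge0 incr.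
  - by move=> i; apply: aeW => x; rewrite /g /stopped min0n /S /drift_sum big_ord0.
  split.
  - exact: (@adapted_stopped _ _ _ F h K FF ah).
  - by move=> m Q _ PQ; exact: (integrable_mixture PQ (ih _)).
  - move=> k m Q km PQ.
    have iQ n : Q.-integrable setT (EFin \o h n).
      exact: (integrable_mixture PQ (ih n)).
    have := cond_exp_eq (sF k) (FM k) (iQ _)
      (is_cond_exp_mixture (FM k) PQ (ih _) (fun i => hM i k m km)).
    by apply: filterS => x ->.
have gg : process_le P g g by move=> i m _; apply: aeW => x; rewrite subrr.
have [C maxC Cg] := exists_maximal_chain gG gg.
exists C, g; split => //.
- split=> // u Cu; have [[CG _] _] := maxC.
  by apply: martingale_compensator_maximal gG (CG _ Cu) => // i m; exact: hM.
- move=> i k m km _.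
  exact: cond_exp_eq (sF k) (FM k) (ih _ i) (hM i k m km).
- move=> i m m1; apply: aeW => x; congr (cond_exp _ _ _ _).
  by apply/funext => y; rewrite stopped_drift_sum_increment// g'E.
Qed.

End compensation.

Theorem theorem7 (d : measure_display) (T : measurableType d) (R : realType)
    (F : nat -> set (set T)) (M : set (probability T R))
    (f gbar : nat -> T -> R)
    (F_filtration : filtration F)
    (M_convex : convex_measures M)
    (M_equivalent : equivalent_measures M)
    (f_supermartingale : supermartingale F M f)
    (f_sup : sup_L1_finite M f)
    (gbar_adapted : forall m, (1 <= m)%N -> measurable_wrt (F m) (gbar m))
    (gbar_ge0 : forall m P, (1 <= m)%N -> M P ->
      \forall x \ae P, 0 <= gbar m x)
    (gbar_integrable : forall m P, (1 <= m)%N -> M P ->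
      P.-integrable setT (EFin \o gbar m))
    (gbar_neq0 : exists2 m, (1 <= m)%N &
      forall P, M P -> (0 < P [set x | (0 < gbar m x)%R])%E)
    (f_gbar : forall m P, (1 <= m)%N -> M P -> \forall x \ae P,
      f m.-1 x - cond_exp P (F m.-1) (f m) x = cond_exp P (F m.-1) (gbar m) x) :
  local_regular F M f.
Proof.
have [af _ _] := f_supermartingale; have [_ _ FM _] := F_filtration.
have [m0 m01 gpos] := gbar_neq0.
have mf m : measurable_fun setT (f m).
  exact: measurable_wrt_measurable (FM m) (af m).
have intf m P : M P -> P.-integrable setT (EFin \o f m).
  move=> MP; apply/integrableP; split; first exact/measurable_EFinP.
  apply: le_lt_trans (f_sup m); apply: ereal_sup_ubound.
  by exists P.
split=> //; exists (fun s => (m0 + s)%N); split.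
- by move=> s t; rewrite ltn_add2l.
- exact: cvg_addnl.
move=> s; set K := (m0 + s)%N.
split=> //; [exact: supermartingale_stopped|exact: stopped_envelope|].
pose gbar' m x := if (1 <= m <= K)%N then gbar m x else 0.
have g'E m x : (1 <= m)%N -> gbar' m x = if (m <= K)%N then gbar m x else 0.
  by rewrite /gbar' => ->.
exists gbar'; split.
- move=> m; rewrite /gbar'; have [/andP[m1 _]|_] := boolP (0 < m <= K)%N.
    exact: gbar_adapted.
  exact: measurable_cst.
- move=> m P MP; rewrite /gbar'; have [/andP[m1 _]|_] := boolP (0 < m <= K)%N.
    exact: gbar_ge0.
  exact: aeW.
- by move=> P _; exact: aeW.
- move=> m P m1 MP; rewrite /gbar' m1/=; have [_|_] := boolP (m <= K)%N.
    exact: gbar_integrable.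
  exact: (finite_measure_integrable_cst P _ measurableT).
- move=> n P MP _.
  apply: (regular_for_drift (m0 := m0) (gbar := gbar)
    F_filtration M_equivalent) => //.
  by rewrite m01 leq_addr.
Qed.
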